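(* Let $X\subset\mathbb{R}^n$ be a closed set with a properly defined inner metric. Then for every $p\in X$, either $p\in\overline{M_X}$ or $X$ is Lipschitz Normally Embedded at $p$ (the ''or'' is inclusive), where $\overline{M_X}$ is the closure in $\mathbb{R}^n$ of the medial axis $M_X$ of $X$.
   Context: $\|\cdot\|$ is the Euclidean norm on $\mathbb{R}^n$. Medial axis: for a closed nonempty $X\subset\mathbb{R}^n$ and $a\in\mathbb{R}^n$ put $d(a,X)=\inf\{\|a-x\| : x\in X\}$ and $m_X(a)=\{x\in X : d(a,X)=\|a-x\|\}$ (the set of closest points in $X$ to $a$). The medial axis of $X$ is $M_X=\{a\in\mathbb{R}^n : \# m_X(a)>1\}$. Inner metric: for a path-connected set $Y\subset\mathbb{R}^n$ and $x,y\in Y$ let $\Gamma_{x,y}$ be the set of (continuous) paths in $Y$ joining $x$ and $y$, and let $\mathrm{len}(\gamma)$ be the length of a curve $\gamma$. $Y$ has a properly defined inner metric if it is path-connected and, for all $x,y\in Y$, $\Gamma_{x,y}$ contains at least one rectifiable curve; the inner metric on $Y$ is then $d_{inn}(x,y)=\inf\{\mathrm{len}(\gamma) : \gamma\in\Gamma_{x,y}\}$. Lipschitz Normally Embedded (LNE): a set $Y\subset\mathbb{R}^n$ with a properly defined inner metric is LNE if the inner metric on $Y$ and the metric induced from $\mathbb{R}^n$ are equivalent, i.e. there is a constant $C>0$ such that $d_{inn}(x,y)\le C\|x-y\|$ for all $x,y\in Y$. LNE at a point: $X$ is Lipschitz Normally Embedded at $p\in X$ if there is an open neighbourhood $U$ of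 $p$ in $\mathbb{R}^n$ such that $X\cap U$ is LNE (with respect to the inner metric of $X\cap U$ itself, which in particular is required to be properly defined). *)

(* Defs.v *)
From HB Require Import structures.
From mathcomp Require Import all_boot all_order all_algebra.
From mathcomp Require Import all_classical all_reals all_analysis.
Import Order.TTheory GRing.Theory Num.Theory.
Import numFieldNormedType.Exports.

Set Implicit Arguments.
Unset Strict Implicit.
Unset Printing Implicit Defensive.

Local Open Scope classical_set_scope.
Local Open Scope ring_scope.

Section InnerMetric.
Context {R : realType} {n : nat}.
Implicit Types (X Y : set 'rV[R]_n) (x y a p : 'rV[R]_n).

(* The norm that the library puts on matrices is the sup norm. It induces the
   same topology as the Euclidean norm, so [open], [closed] and [closure] on
   ['rV[R]_n] are the usual ones, but lengths and distances must be measured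
   with [enorm]. *)
Definition enorm x : R := Num.sqrt (\sum_(i < n) x 0 i ^+ 2).

Definition dist a X : R := inf [set enorm (a - x) | x in X].

Definition closest_points X a : set 'rV[R]_n :=
  [set x | X x /\ dist a X = enorm (a - x)].

(* At least two closest points. *)
Definition medial_axis X : set 'rV[R]_n :=
  [set a | (`I_2 #<= closest_points X a)%card].

(* Paths are parametrized by [0, 1]; the values outside it are irrelevant. *)
Definition paths Y x y : set (R -> 'rV[R]_n) :=
  [set g : R -> 'rV[R]_n |
    [/\ {within `[0, 1], continuous g},
        (forall t : R, 0 <= t <= 1 -> Y (g t)), g 0 = x & g 1 = y]].

(* Vector-valued analogue of [variation] and [total_variation]. *)
Definition polygonal_length (a b : R) (g : R -> 'rV[R]_n) (s : seq R) : R :=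
  let G := g \o nth b (a :: s) in
  \sum_(0 <= k < size s) enorm (G k.+1 - G k).

Definition path_length (g : R -> 'rV[R]_n) : \bar R :=
  ereal_sup [set (polygonal_length 0 1 g s)%:E | s in itv_partition (0 : R) 1].

Definition rectifiable (g : R -> 'rV[R]_n) : Prop := (path_length g < +oo)%E.

Definition path_connected Y : Prop :=
  forall x y, Y x -> Y y -> exists g, paths Y x y g.

Definition has_inner_metric Y : Prop :=
  path_connected Y /\
  forall x y, Y x -> Y y -> exists2 g, paths Y x y g & rectifiable g.

Definition inner_dist Y x y : \bar R :=
  ereal_inf [set path_length g | g in paths Y x y].

Definition LNE Y : Prop :=
  has_inner_metric Y /\
  exists2 C : R, 0 < C &
    forall x y, Y x -> Y y -> (inner_dist Y x y <= (C * enorm (x - y))%:E)%E.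

Definition LNE_at X p : Prop :=
  exists U : set 'rV[R]_n, [/\ open U, U p & LNE (X `&` U)].

End InnerMetric.

(* Main.v *)
Require Import Defs.
From mathcomp Require Import all_boot all_order all_algebra.
From mathcomp Require Import all_classical all_reals all_analysis.
From mathcomp Require Import ring lra.
Import Order.TTheory GRing.Theory Num.Theory.
Import numFieldNormedType.Exports.
Local Open Scope classical_set_scope.
Local Open Scope ring_scope.

(** If [p] is not in the closure of the medial axis, then every point of some
    ball around [p] has a unique closest point in [X]. As in Federer's theory
    of sets of positive reach, this forces [X] to have touching balls near
    [p]: for [a] close to [p] with closest point [z], some ball of fixed radius
    [e] that touches [X] at [z] on the side of [a] has no point of [X] inside
    ([touching_ball]).

    Federer obtains these balls by following the gradient flow of the distance
    function. Here they come from a maximum principle. Uniqueness makes the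
    closest point continuous, so the distance to [X] has slope 1 at each point
    off [X] ([dist_slope]); a function with slope 1 that is 1-Lipschitz grows by
    exactly [e] over a ball of radius [e] ([dist_growth]); and the point [b] where
    this growth is attained is the centre of a ball of radius [e + dist a X]
    that touches [X] at [z] and contains the ball sought.

    Touching balls have two consequences, obtained by testing the inequality
    at one closest point on other points of [X] and adding up: the closest
    point is a Lipschitz function near [p] ([closest_points_lipschitz]), and
    the chord between two points [x], [y] of [X] is at distance at most
    [t (1 - t) |x - y|^2 / e] from [X] at parameter [t] ([dist_segment]). Project
    the chord to [X]. The first fact bounds the length of the projected path
    by a multiple of [|x - y|]; the second says that projecting moves the points
    of the chord by less than the strict convexity of balls can absorb, so the
    path stays in any small ball around [p] that contains [x] and [y]
    ([closest_point_segment_in_eball]). Hence the intersection of [X] with such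
    a ball is Lipschitz normally embedded. *)

(** * Euclidean space *)

Section EuclideanSpace.
Context {R : realType} {n : nat}.
Implicit Types (u v w p : 'rV[R]_n) (k t : R).

Definition dot u v : R := \sum_(i < n) u 0 i * v 0 i.

Lemma dotC u v : dot u v = dot v u.
Proof. by apply: eq_bigr => i _; rewrite mulrC. Qed.

Lemma dotDl u v w : dot (u + v) w = dot u w + dot v w.
Proof. by rewrite -big_split; apply: eq_bigr => i _; rewrite mxE mulrDl. Qed.

Lemma dotZl k u v : dot (k *: u) v = k * dot u v.
Proof. by rewrite mulr_sumr; apply: eq_bigr => i _; rewrite mxE mulrA. Qed.

Lemma dotNl u v : dot (- u) v = - dot u v.
Proof. by rewrite -scaleN1r dotZl mulN1r. Qed.

Lemma dotDr u v w : dot w (u + v) = dot w u + dot w v.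
Proof. by rewrite !(dotC w) dotDl. Qed.

Lemma dotZr k u v : dot u (k *: v) = k * dot u v.
Proof. by rewrite !(dotC u) dotZl. Qed.

Lemma dotNr u v : dot u (- v) = - dot u v.
Proof. by rewrite !(dotC u) dotNl. Qed.

Definition dotE := (dotDl, dotDr, dotNl, dotNr, dotZl, dotZr).

Lemma dotDD u v : dot (u + v) (u + v) = dot u u + 2 * dot u v + dot v v.
Proof. by rewrite !dotE (dotC v u); ring. Qed.

Lemma dotBB u v : dot (u - v) (u - v) = dot u u - 2 * dot u v + dot v v.
Proof. by rewrite dotDD !(dotNl, dotNr); ring. Qed.

Lemma dot_ge0 u : 0 <= dot u u.
Proof. by apply: sumr_ge0 => i _; rewrite -expr2 sqr_ge0. Qed.

Lemma sqr_enorm u : enorm u ^+ 2 = dot u u.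
Proof.
rewrite sqr_sqrtr; first by apply: eq_bigr => i _; rewrite expr2.
by apply: sumr_ge0 => i _; rewrite sqr_ge0.
Qed.

Lemma enorm_ge0 u : 0 <= enorm u.
Proof. exact: sqrtr_ge0. Qed.

Lemma ge0_enorm_le u k : 0 <= k -> (enorm u <= k) = (dot u u <= k ^+ 2).
Proof. by move=> k0; rewrite -sqr_enorm ler_sqr ?nnegrE ?enorm_ge0. Qed.

Lemma ge0_le_enorm u k : 0 <= k -> (k <= enorm u) = (k ^+ 2 <= dot u u).
Proof. by move=> k0; rewrite -sqr_enorm ler_sqr ?nnegrE ?enorm_ge0. Qed.

Lemma enorm_eq0 u : enorm u = 0 -> u = 0.
Proof.
move=> u0; have /eqP : dot u u = 0 by rewrite -sqr_enorm u0 expr0n.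
rewrite psumr_eq0 => [/allP/= ui0|i _]; last by rewrite -expr2 sqr_ge0.
apply/rowP => i; apply/eqP; rewrite mxE.
by rewrite -[_ == 0]orbb -mulf_eq0 ui0 ?mem_index_enum.
Qed.

Lemma enorm0 : enorm (0 : 'rV[R]_n) = 0.
Proof.
apply/eqP; rewrite eq_le enorm_ge0 ge0_enorm_le// andbT.
by rewrite -(scale0r 0) dotZl mul0r expr0n.
Qed.

Lemma enormB u v : enorm (u - v) = enorm (v - u).
Proof.
by apply/eqP; rewrite -(@eqrXn2 _ 2) ?enorm_ge0// !sqr_enorm -opprB dotNl dotNr opprK.
Qed.

Lemma enormZ k u : enorm (k *: u) = `|k| * enorm u.
Proof.
apply/eqP; rewrite -(@eqrXn2 _ 2) ?mulr_ge0 ?enorm_ge0//.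
by rewrite exprMn !sqr_enorm dotZl dotZr mulrA real_normK ?num_real// expr2.
Qed.

Lemma dot_le_enorm u v : dot u v <= enorm u * enorm v.
Proof.
have [u0|u0] := eqVneq (enorm u) 0.
  by rewrite u0 mul0r (enorm_eq0 _ u0) -(scale0r 0) dotZl mul0r.
have [v0|v0] := eqVneq (enorm v) 0.
  by rewrite v0 mulr0 (enorm_eq0 _ v0) -(scale0r 0) dotZr mul0r.
have up : 0 < enorm u by rewrite lt_neqAle eq_sym u0 enorm_ge0.
have vp : 0 < enorm v by rewrite lt_neqAle eq_sym v0 enorm_ge0.
have := dot_ge0 (enorm v *: u - enorm u *: v).
have -> : dot (enorm v *: u - enorm u *: v) (enorm v *: u - enorm u *: v) =
    2 * (enorm u * enorm v) * (enorm u * enorm v - dot u v).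
  by rewrite !dotE -!sqr_enorm (dotC v u); ring.
by rewrite pmulr_rge0 ?subr_ge0// mulr_gt0// mulr_gt0.
Qed.

Lemma ler_enormD u v : enorm (u + v) <= enorm u + enorm v.
Proof.
rewrite ge0_enorm_le ?addr_ge0 ?enorm_ge0// !dotE (dotC v u) -!sqr_enorm.
by have := dot_le_enorm u v; nra.
Qed.

Lemma enorm_triangle w u v : enorm (u - v) <= enorm (u - w) + enorm (w - v).
Proof. by apply: le_trans (ler_enormD _ _); rewrite addrA subrK. Qed.

(** The topology on row vectors is that of the sup norm; this comparison and the
    continuity of [enorm] make the two norms interchangeable in what follows. *)
Lemma norm_le_enorm u : `|u| <= enorm u.
Proof.
rewrite [leLHS]mx_normrE; apply/bigmax_leP; split; first exact: enorm_ge0.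
move=> [i j] _ /=; rewrite (ord1 i) -ler_sqr ?nnegrE ?enorm_ge0// sqr_enorm.
rewrite real_normK ?num_real// /dot (bigD1 j)//= -expr2 lerDl.
by apply: sumr_ge0 => l _; rewrite -expr2 sqr_ge0.
Qed.

Lemma eball_convex p u v k t : 0 <= t <= 1 ->
  enorm (p - u) < k -> enorm (p - v) < k ->
  enorm (p - ((1 - t) *: u + t *: v)) < k.
Proof.
move=> /andP[t0 t1] pu pv.
have -> : p - ((1 - t) *: u + t *: v) = (1 - t) *: (p - u) + t *: (p - v).
  by apply/rowP => i; rewrite !mxE; ring.
apply: le_lt_trans (ler_enormD _ _) _; rewrite !enormZ !ger0_norm ?subr_ge0//.
move: t0; rewrite le_eqVlt => /predU1P[<-|t0]; first lra.
have : 0 < t * (k - enorm (p - v)) by rewrite mulr_gt0 ?subr_gt0.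
have : 0 <= (1 - t) * (k - enorm (p - u)) by rewrite mulr_ge0 ?subr_ge0// ltW.
lra.
Qed.

Lemma enorm_continuous : continuous (enorm : 'rV[R]_n -> R).
Proof.
move=> u; apply: (continuous_comp (g := Num.sqrt)); last exact: sqrt_continuous.
apply: (@cvg_big _ _ +%R 0 _ add_continuous _ (nbhs u)) => i _.
by rewrite expr2; apply: cvgM; exact: coord_continuous.
Qed.

Lemma enorm_subl_continuous u : continuous (fun v => enorm (u - v)).
Proof.
move=> v; apply: (@continuous_comp _ _ _ (fun v => u - v) enorm).
  by have := cvgB (cvg_cst u) (@cvg_id _ (nbhs v)); exact.
exact: enorm_continuous.
Qed.

Lemma closed_eball u k : closed [set v | enorm (u - v) <= k].
Proof.
apply: (@preimage_closed _ _ (fun v => enorm (u - v)) [set x | x <= k]).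
  by move=> v _; exact: enorm_subl_continuous.
exact: closed_le.
Qed.

Lemma open_eball u k : open [set v | enorm (u - v) < k].
Proof.
apply: (@open_comp _ _ (fun v => enorm (u - v)) [set x | x < k]).
  by move=> v _; exact: enorm_subl_continuous.
exact: open_lt.
Qed.

Lemma closed_eball_exterior u k : closed [set v | k <= enorm (u - v)].
Proof.
apply: (@preimage_closed _ _ (fun v => enorm (u - v)) [set x | k <= x]).
  by move=> v _; exact: enorm_subl_continuous.
exact: closed_ge.
Qed.

Lemma compact_eball u k : compact [set v | enorm (u - v) <= k].
Proof.
apply: bounded_closed_compact; last exact: closed_eball.
exists (enorm u + k); split; first exact: num_real.
move=> M kM v /= vk; apply: le_trans (norm_le_enorm _) _.
apply: le_trans (ltW kM).
have := enorm_triangle u v 0; rewrite !subr0 (enormB v u); lra.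
Qed.

End EuclideanSpace.

Section ClosestPoints.
Context {R : realType} {n : nat}.
Implicit Types (X : set 'rV[R]_n) (a b c m p x y z w : 'rV[R]_n).

(** * Closest points and the distance function *)

Lemma dist_le X a y : X y -> dist a X <= enorm (a - y).
Proof.
move=> Xy; apply: ge_inf; last by exists y.
by exists 0 => _ [x _ <-]; exact: enorm_ge0.
Qed.

Lemma closest_pointsP X a z :
  X z -> (forall y, X y -> enorm (a - z) <= enorm (a - y)) -> closest_points X a z.
Proof.
move=> Xz zmin; split=> //; apply/eqP; rewrite eq_le dist_le//=.
apply: lb_le_inf; first by exists (enorm (a - z)), z.
by move=> _ [y Xy <-]; exact: zmin.
Qed.

Lemma closest_points_nonempty X a : closed X -> X !=set0 ->
  exists z, closest_points X a z.
Proof.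
move=> Xcl [y0 Xy0].
pose A := X `&` [set y | enorm (a - y) <= enorm (a - y0)].
have Ay0 : A y0 by split=> /=.
have Acpt : compact A by rewrite /A setIC; apply: compact_closedI => //; exact: compact_eball.
have [//|z /set_mem[Xz _] zmin] := @EVT_min_rV R n (fun y => enorm (a - y)) A
  (ex_intro _ y0 Ay0) Acpt.
  by apply: continuous_subspaceT; exact: enorm_subl_continuous.
exists z; apply: closest_pointsP => // y Xy.
have [ya|ya] := leP (enorm (a - y)) (enorm (a - y0)).
  by apply: zmin; apply: mem_set; split.
by apply: le_trans (ltW ya); apply: zmin; apply: mem_set.
Qed.

Lemma dist_lipschitz X a b : X !=set0 -> dist a X <= dist b X + enorm (a - b).
Proof.
move=> [x Xx]; rewrite -lerBlDr; apply: lb_le_inf; first by exists (enorm (b - x)), x.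
move=> _ [y Xy <-]; rewrite lerBlDr addrC.
by apply: le_trans (enorm_triangle b a y); exact: dist_le.
Qed.

Lemma dist_continuous X : X !=set0 -> continuous (fun a => dist a X).
Proof.
move=> X0 a; apply/(@cvgrPdist_le _ _ _ (nbhs a)) => e e0; near=> b.
have : enorm (a - b) < e.
  near: b; apply: open_nbhs_nbhs; split; first exact: open_eball.
  by rewrite /= subrr enorm0.
have := dist_lipschitz X a b X0; have := dist_lipschitz X b a X0.
rewrite (enormB b a) ler_distl; lra.
Unshelve. all: by end_near. Qed.

Lemma unique_closest_point X a z w : ~ medial_axis X a ->
  closest_points X a z -> closest_points X a w -> z = w.
Proof.
move=> aM az aw; apply: contrapT => zw; apply: aM.
apply/pcard_geP/surjPex; exists (fun v => if v == z then 0%N else 1%N).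
move=> [_|[_|//]]; [exists z => //|exists w => //]; rewrite ?eqxx//.
by case: eqP => // wz; case: zw.
Qed.

(** Compactness: the points of [X] at distance at least [e] from [z] form a closed
    set, which is strictly farther from [c] than [X] is, and half of that gap is
    a suitable [d]. *)
Lemma closest_point_continuous X c z e :
  closed X -> closest_points X c z -> 0 < e ->
  (forall w, closest_points X c w -> w = z) ->
  exists2 d, 0 < d & forall b w, enorm (b - c) < d -> closest_points X b w ->
    enorm (z - w) < e.
Proof.
move=> Xcl cz e0 zuniq.
pose Y := X `&` [set w | e <= enorm (z - w)].
have Ycl : closed Y by apply: closedI => //; exact: closed_eball_exterior.
have [Y0|/nonemptyPn Y0] := pselect (Y !=set0); last first.
  exists 1 => // b w _ [Xw _]; rewrite ltNge; apply/negP => ew.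
  by have : Y w by []; rewrite Y0.
have [y [[Xy /= ye] ymin]] := closest_points_nonempty Y c Ycl Y0.
have cy : dist c X < enorm (c - y).
  rewrite lt_neqAle dist_le// andbT; apply/eqP => cy.
  by move: ye; rewrite (zuniq y) ?subrr ?enorm0; [lra|].
exists ((enorm (c - y) - dist c X) / 2); first lra.
move=> b w bc [Xw bw]; rewrite ltNge; apply/negP => ew.
have : dist c Y <= enorm (c - w) by apply: dist_le.
have := enorm_triangle b c w; have := dist_lipschitz X b c (ex_intro _ w Xw).
rewrite (enormB c b); lra.
Qed.

(** * Growth of the distance where closest points are unique *)

(** Where the closest point is unique, the distance to [X] has slope 1, along the
    ray that leaves [X]. Writing [w] for the closest point to
    [b = c + k (c - z)], we have
    [|b - w|^2 = |c - w|^2 + 2 k <c - w, c - z> + k^2 |c - z|^2], where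
    [|c - w| >= |c - z|] and [w] is close to [z] by continuity of the closest
    point. *)
Lemma dist_slope X c z (eta d : R) :
  closed X -> ~ medial_axis X c -> closest_points X c z -> 0 < dist c X ->
  0 <= eta < 1 -> 0 < d ->
  exists2 b, enorm (b - c) < d & dist c X + eta * enorm (b - c) < dist b X.
Proof.
move=> Xcl cM cz; have [Xz dE] := cz; rewrite dE; set D := enorm (c - z).
move=> D0 /andP[eta0 eta1] d0.
have [||r r0 zcont] := closest_point_continuous X c z (D * (1 - eta) / 2) Xcl cz.
- by rewrite divr_gt0// mulr_gt0// subr_gt0.
- by move=> w cw; exact: unique_closest_point cM cw cz.
pose m := Num.min d r; have m0 : 0 < m by rewrite lt_min d0.
have [md mr] : m <= d /\ m <= r by rewrite !ge_min !lexx orbT.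
pose k := m / (2 * D); have k0 : 0 < k by rewrite divr_gt0 ?mulr_gt0.
have km : k * D < m.
  have -> : k * D = m / 2 by rewrite /k; field; rewrite gt_eqF.
  lra.
pose b := c + k *: (c - z).
have bc : enorm (b - c) = k * D by rewrite /b addrC addKr enormZ gtr0_norm.
have [w bw] := closest_points_nonempty X b Xcl (ex_intro _ z Xz).
exists b; rewrite bc; first lra.
have /ltW zw : enorm (z - w) < D * (1 - eta) / 2 by apply: zcont bw; rewrite bc; lra.
have [Xw ->] := bw; rewrite ltNge ge0_enorm_le; last first.
  by have := mulr_gt0 k0 D0; have := ltW D0; nra.
apply/negP.
have : D ^+ 2 <= dot (c - w) (c - w).
  by rewrite -ge0_le_enorm; [rewrite /D -dE; exact: dist_le|exact: ltW].
have -> : b - w = (c - w) + k *: (c - z) by rewrite /b addrAC.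
have : dot (c - z) (w - z) <= D * (D * (1 - eta) / 2).
  apply: le_trans (dot_le_enorm _ _) _; rewrite (enormB w z).
  by apply: ler_wpM2l => //; exact: ltW.
have -> : dot (c - z) (w - z) = D ^+ 2 - dot (c - w) (c - z).
  by rewrite /D sqr_enorm !dotE !(dotC _ c) !(dotC w z); ring.
move=> sD qD.
have -> : dot (c - w + k *: (c - z)) (c - w + k *: (c - z)) =
    dot (c - w) (c - w) + 2 * k * dot (c - w) (c - z) + k ^+ 2 * D ^+ 2.
  by rewrite /D sqr_enorm dotDl !(dotDr _ (k *: _)) !dotZl !dotZr (dotC (c - z) (c - w)); ring.
move: (dot (c - w) (c - z)) (dot (c - w) (c - w)) sD qD => s q sD qD qle.
have : 0 < k * D ^+ 2 * (1 - eta).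
  by rewrite mulr_gt0 ?subr_gt0// mulr_gt0// exprn_gt0.
have : 0 <= (k * D) ^+ 2 * (1 - eta ^+ 2).
  by rewrite mulr_ge0 ?sqr_ge0//; nra.
have : 0 <= k * (2 * (D * (D * (1 - eta) / 2) - (D ^+ 2 - s))).
  by apply: mulr_ge0; [exact: ltW|lra].
nra.
Qed.

(** An Ekeland-type argument turns the slope condition into growth at unit rate over
    a whole ball. For [eta < 1] a maximum of [dist - eta |a - _|] over the ball
    cannot lie in its interior, by [dist_slope]; so it lies on the sphere, where
    it shows that [dist] exceeds [dist a X + eta e]. Now let [eta] tend to 1. *)
Lemma dist_growth X a (e : R) : closed X -> X !=set0 ->
  (forall b, enorm (a - b) <= e -> ~ medial_axis X b) ->
  0 < e -> 0 < dist a X ->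
  exists2 b, enorm (a - b) <= e & dist a X + e <= dist b X.
Proof.
move=> Xcl X0 eM e0 a0.
have aball : [set b | enorm (a - b) <= e] a by rewrite /= subrr enorm0 ltW.
have [|b /set_mem/= be bmax] := @EVT_max_rV R n (fun b => dist b X) _
    (ex_intro _ a aball) (compact_eball a e).
  by apply: continuous_subspaceT; exact: dist_continuous.
exists b => //.
have key eta : 0 <= eta < 1 -> dist a X + eta * e <= dist b X.
  move=> eta01; have /andP[eta0 eta1] := eta01.
  have [|c /set_mem/= ce cmax] := @EVT_max_rV R n
      (fun b => dist b X - eta * enorm (a - b)) _ (ex_intro _ a aball) (compact_eball a e).
    apply: continuous_subspaceT => x.
    have dx := dist_continuous X X0 x; have ax := enorm_subl_continuous a x.
    exact: (cvgB dx (cvgM (cvg_cst eta) ax)).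
  have ac : dist a X <= dist c X - eta * enorm (a - c).
    have := cmax a (mem_set aball); rewrite subrr enorm0; lra.
  have [ec|ce'] := leP e (enorm (a - c)).
    have := bmax c (mem_set ce); nra.
  have c0 : 0 < dist c X by have := enorm_ge0 (a - c); nra.
  have [z cz] := closest_points_nonempty X c Xcl X0.
  have [|x xc] := dist_slope X c z eta (e - enorm (a - c)) Xcl (eM c ce) cz c0 eta01.
    by rewrite subr_gt0.
  have tri := enorm_triangle c a x; rewrite (enormB x c) in xc *.
  have xe : enorm (a - x) <= e by lra.
  have := cmax x (mem_set xe); nra.
(* If the maximum b fell short by g > 0, then eta = 1 - g / (2 e) would
   contradict the bound just proved. *)
rewrite leNgt; apply/negP => blt.
have ab : dist a X <= dist b X by have := key 0; rewrite mul0r addr0 lexx ltr01; exact.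
pose g := dist a X + e - dist b X.
have /key : 0 <= 1 - g / (2 * e) < 1.
  have : 0 < g / (2 * e) by rewrite divr_gt0 ?subr_gt0 ?mulr_gt0.
  have : g / (2 * e) <= 1 by rewrite ler_pdivrMr ?mulr_gt0// /g; lra.
  lra.
have -> : (1 - g / (2 * e)) * e = e - g / 2 by field; rewrite gt_eqF.
rewrite /g; lra.
Qed.

(** * Touching balls *)

(** Expanding the square shows that, for [a] outside [X], this says that no point of
    [X] lies in the open ball of radius [e] that touches [X] at [z] and is
    centred on the ray from [z] through [a]. In this inner product form it
    also makes sense when [a = z], and it is the form in which two such
    conditions can be added up. *)
Definition touching_balls X (e : R) a : Prop :=
  forall z y, closest_points X a z -> X y ->
    2 * e * dot (a - z) (y - z) <= enorm (a - z) * dot (y - z) (y - z).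

(** The point [b] given by [dist_growth] satisfies
    [|b - z| <= |b - a| + |a - z| <= e + dist a X <= dist b X <= |b - z|]. The case
    of equality in the triangle inequality puts [b] on the ray from [z] through
    [a], and [z] is closest to [b] as well. So the ball centred at [b] that passes
    through [z], of radius [e + dist a X], has no point of [X] inside, and it
    contains the ball of radius [e] tangent to it at [z]. *)
Lemma touching_ball X a (e : R) : closed X -> 0 < e ->
  (forall b, enorm (a - b) <= e -> ~ medial_axis X b) -> touching_balls X e a.
Proof.
move=> Xcl e0 eM z y [Xz dE] Xy; set D := enorm (a - z).
have [D0|D0] := eqVneq D 0.
  by rewrite D0 (enorm_eq0 _ D0) -(scale0r 0) dotZl !mul0r mulr0.
have {}D0 : 0 < D by rewrite lt_neqAle eq_sym D0 enorm_ge0.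
have [|b ab db] := dist_growth X a e Xcl (ex_intro _ z Xz) eM e0; first by rewrite dE.
rewrite dE -/D in db.
pose k := e / D; have k0 : 0 < k by rewrite divr_gt0.
have kD : k * D = e by rewrite /k divfK ?gt_eqF.
(* Equality in the triangle inequality. *)
have abE : b - a = k *: (a - z).
  apply/eqP; rewrite -subr_eq0; apply/eqP/enorm_eq0/eqP.
  rewrite eq_le enorm_ge0 andbT ge0_enorm_le// expr0n/=.
  have : (D + e) ^+ 2 <= dot (b - z) (b - z).
    rewrite -ge0_le_enorm; last lra.
    by apply: le_trans db _; exact: dist_le.
  have -> : b - z = (b - a) + (a - z) by rewrite addrA subrK.
  have : dot (b - a) (b - a) <= e ^+ 2.
    by rewrite -ge0_enorm_le; [rewrite enormB|exact: ltW].
  rewrite (dotDD (b - a)) (dotBB (b - a)) dotZl !dotZr -(sqr_enorm (a - z)) -/D.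
  move: (dot (b - a) (b - a)) (dot (b - a) (a - z)) => q s qe qs.
  have : 0 <= k * (s - D * e) by apply: mulr_ge0; [exact: ltW|lra].
  by rewrite -kD in qe *; lra.
have : (D + e) ^+ 2 <= dot (b - y) (b - y).
  rewrite -ge0_le_enorm; last lra.
  by apply: le_trans db _; exact: dist_le.
have -> : b - y = (1 + k) *: (a - z) - (y - z).
  by rewrite scalerDl scale1r -abE; apply/rowP => i; rewrite !mxE; ring.
rewrite (dotBB (_ *: _)) !dotZl dotZr -(sqr_enorm (a - z)) -/D.
have := dot_ge0 (y - z).
move: (dot (y - z) (y - z)) (dot (a - z) (y - z)) => q s q0 h.
have {}h : 2 * (1 + k) * s <= q by rewrite -kD in h; lra.
have {}h : 2 * (D + e) * s <= D * q.
  have : 0 <= D * (q - 2 * (1 + k) * s) by apply: mulr_ge0; [exact: ltW|lra].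
  rewrite -kD; lra.
have Dq : 0 <= D * q by apply: mulr_ge0 => //; exact: ltW.
have [s0|s0] := leP 0 s.
  have : 0 <= D * s by apply: mulr_ge0 => //; exact: ltW.
  lra.
have : e * s <= 0 by rewrite pmulr_rle0// ltW.
lra.
Qed.

(** Federer's estimate: the touching ball inequality at [z] tested on [w], added to
    the one at [w] tested on [z], bounds [|z - w|^2] by a multiple of
    [<b - a, w - z>]. *)
Lemma closest_points_lipschitz X (K : R) a b z w : 0 < K ->
  touching_balls X K a -> touching_balls X K b ->
  closest_points X a z -> closest_points X b w ->
  dist a X + dist b X <= K -> enorm (z - w) <= 2 * enorm (a - b).
Proof.
move=> K0 Ka Kb az bw; have [Xz ->] := az; have [Xw ->] := bw => dK.
have := Ka z w az Xw; have := Kb w z bw Xz.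
have [zw|zw] := eqVneq (enorm (z - w)) 0.
  by rewrite zw => _ _; rewrite mulr_ge0 ?enorm_ge0.
have {}zw : 0 < enorm (z - w) by rewrite lt_neqAle eq_sym zw enorm_ge0.
rewrite -!sqr_enorm (enormB w z).
have -> : dot (b - w) (z - w) = - dot (b - w) (w - z).
  by rewrite -(opprB w z) dotNr.
have := dot_le_enorm (b - a) (w - z); rewrite (enormB b) (enormB w).
have -> : dot (b - a) (w - z) = dot (b - w) (w - z) - dot (a - z) (w - z) + enorm (z - w) ^+ 2.
  by rewrite sqr_enorm !dotE; ring.
move: (dot (b - w) (w - z)) (dot (a - z) (w - z)) => s r h1 h2 h3.
rewrite -(ler_pM2r zw) -(ler_pM2l K0).
have : 0 <= (K - (enorm (a - z) + enorm (b - w))) * enorm (z - w) ^+ 2.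
  by rewrite mulr_ge0 ?subr_ge0 ?sqr_ge0.
have : 0 <= K * (enorm (a - b) * enorm (z - w) - (s - r + enorm (z - w) ^+ 2)).
  by apply: mulr_ge0; [exact: ltW|rewrite subr_ge0].
lra.
Qed.

(** A set with touching balls is almost convex: chords stray from it only
    quadratically in their length. The inequalities at [z] tested on [x] and on
    [y], averaged with weights [1 - t] and [t], have [|m - z|^2] as left-hand inner
    product. *)
Lemma dist_segment X (K t : R) x y : 0 < K -> 0 <= t <= 1 -> X x -> X y ->
  let m := (1 - t) *: x + t *: y in
  forall z, closest_points X m z ->
  touching_balls X K m -> dist m X <= K ->
  K * dist m X <= t * (1 - t) * enorm (x - y) ^+ 2.
Proof.
move=> K0 /andP[t0 t1] Xx Xy m z mz Km; have [Xz ->] := mz => mK.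
have [m0|m0] := eqVneq (enorm (m - z)) 0.
  rewrite m0 mulr0; apply: mulr_ge0; [apply: mulr_ge0 => //; by rewrite subr_ge0|exact: sqr_ge0].
have {}m0 : 0 < enorm (m - z) by rewrite lt_neqAle eq_sym m0 enorm_ge0.
have hx := Km z x mz Xx; have hy := Km z y mz Xy.
have E1 : (1 - t) * dot (m - z) (x - z) + t * dot (m - z) (y - z) = enorm (m - z) ^+ 2.
  rewrite sqr_enorm -!dotZr -dotDr; congr dot.
  by rewrite /m; apply/rowP => i; rewrite !mxE; ring.
have E2 : (1 - t) * dot (x - z) (x - z) + t * dot (y - z) (y - z) =
    enorm (m - z) ^+ 2 + t * (1 - t) * enorm (x - y) ^+ 2.
  by rewrite !sqr_enorm /m !dotE !(dotC y) !(dotC z x); ring.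
rewrite -(ler_pM2l m0).
have h1 : 0 <= (1 - t) * (enorm (m - z) * dot (x - z) (x - z) - 2 * K * dot (m - z) (x - z)).
  by rewrite mulr_ge0 ?subr_ge0.
have h2 : 0 <= t * (enorm (m - z) * dot (y - z) (y - z) - 2 * K * dot (m - z) (y - z)).
  by rewrite mulr_ge0 ?subr_ge0.
have h3 : 0 <= (K - enorm (m - z)) * enorm (m - z) ^+ 2.
  by rewrite mulr_ge0 ?subr_ge0 ?sqr_ge0.
have : 2 * K * enorm (m - z) ^+ 2 <=
    enorm (m - z) * (enorm (m - z) ^+ 2 + t * (1 - t) * enorm (x - y) ^+ 2).
  by rewrite -E2 -E1; lra.
lra.
Qed.

(** The point [m] of the chord lies deeper inside the ball than its ends: by Stewart's
    identity [|p - m|^2] falls short of the average of [|p - x|^2] and [|p - y|^2] by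
    [t (1 - t) |x - y|^2]. By [dist_segment], this pays for the move from
    [m] to [z]. *)
Lemma closest_point_segment_in_eball X (K r t : R) p x y z :
  0 < K -> 3 * r <= K -> 0 <= t <= 1 -> X x -> X y ->
  enorm (p - x) < r -> enorm (p - y) < r ->
  let m := (1 - t) *: x + t *: y in
  closest_points X m z -> touching_balls X K m -> dist m X <= r ->
  enorm (p - z) < r.
Proof.
move=> K0 rK t01 Xx Xy px py m mz Km mr.
have r0 : 0 < r by apply: le_lt_trans px; exact: enorm_ge0.
have mK : dist m X <= K by lra.
have := dist_segment X K t x y K0 t01 Xx Xy z mz Km mK; have [Xz dE] := mz.
rewrite -/m dE; rewrite dE in mr.
have E : enorm (p - m) ^+ 2 =
    (1 - t) * enorm (p - x) ^+ 2 + t * enorm (p - y) ^+ 2 - t * (1 - t) * enorm (x - y) ^+ 2.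
  by rewrite !sqr_enorm /m !dotE !(dotC y) !(dotC x p); ring.
have T0 : 0 <= t * (1 - t) * enorm (x - y) ^+ 2.
  by case/andP: t01 => t0 t1; rewrite mulr_ge0 ?sqr_ge0// mulr_ge0 ?subr_ge0.
have chord : (1 - t) * enorm (p - x) ^+ 2 + t * enorm (p - y) ^+ 2 < r ^+ 2.
  have px2 : enorm (p - x) ^+ 2 < r ^+ 2 by rewrite ltr_sqr ?nnegrE ?enorm_ge0 ?ltW.
  have py2 : enorm (p - y) ^+ 2 < r ^+ 2 by rewrite ltr_sqr ?nnegrE ?enorm_ge0 ?ltW.
  case/andP: t01; rewrite le_eqVlt => /predU1P[<-|t0] t1; first lra.
  have : 0 < t * (r ^+ 2 - enorm (p - y) ^+ 2) by rewrite mulr_gt0 ?subr_gt0.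
  have : 0 <= (1 - t) * (r ^+ 2 - enorm (p - x) ^+ 2).
    by rewrite mulr_ge0 ?subr_ge0// ltW.
  lra.
have pm : enorm (p - m) <= r.
  by rewrite -ler_sqr ?nnegrE ?enorm_ge0 ?(ltW r0)// E; lra.
have := enorm_triangle m p z; have := enorm_ge0 (m - z); have := enorm_ge0 (p - m).
move: (enorm (p - m)) (enorm (m - z)) pm mr E => u s ur sr E u0 s0 tri Ks.
apply: le_lt_trans tri _; rewrite -ltr_sqr ?nnegrE ?addr_ge0 ?(ltW r0)//.
have : 0 <= s * (K - (2 * u + s)) by rewrite mulr_ge0 ?subr_ge0//; lra.
lra.
Qed.

(** * Lipschitz paths *)

Lemma path_length_lipschitz (g : R -> 'rV[R]_n) (L : R) :
  (forall s t, 0 <= s <= 1 -> 0 <= t <= 1 -> enorm (g s - g t) <= L * `|s - t|) ->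
  (path_length g <= L%:E)%E.
Proof.
move=> gL; apply: ge_ereal_sup => _ [s s01 <-]; rewrite lee_fin.
pose T := nth 1 (0 :: s).
have T01 k : (k < (size s).+1)%N -> 0 <= T k <= 1.
  move=> ks; rewrite (itv_partition_nth_ge ks s01)/=.
  exact: (itv_partition_nth_le ks s01).
have -> : L = \sum_(0 <= k < size s) (L * T k.+1 - L * T k).
  rewrite telescope_sumr//.
  by rewrite /T (itv_partition_nth_size 1 s01)/= mulr0 subr0 mulr1.
rewrite /polygonal_length big_nat_cond [leRHS]big_nat_cond.
apply: ler_sum => k /andP[/andP[_ ks] _].
apply: le_trans (gL _ _ _ _) _; rewrite ?T01//; first exact: ltnW.
rewrite -mulrBr ger0_norm// subr_ge0.
have [/pathP h _] := s01.
by apply/ltW/h.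
Qed.

Lemma lipschitz_within_continuous (g : R -> 'rV[R]_n) (L : R) :
  (forall s t, 0 <= s <= 1 -> 0 <= t <= 1 -> enorm (g s - g t) <= L * `|s - t|) ->
  {within `[0, 1], continuous g}.
Proof.
move=> gL; apply/subspace_continuousP => t /=; rewrite in_itv/= => t01.
apply/(@cvgrPdist_le _ _ _ (within _ (nbhs t))) => e e0.
have L1 : 0 < `|L| + 1 by rewrite ltr_wpDl.
rewrite near_withinE; near=> s => /=; rewrite in_itv/= => s01.
apply: le_trans (norm_le_enorm _) _; apply: le_trans (gL _ _ t01 s01) _.
have : `|t - s| <= e / (`|L| + 1).
  near: s; apply: cvgr_dist_le => //.
  by rewrite divr_gt0.
rewrite ler_pdivlMr//; apply: le_trans; rewrite mulrC ler_wpM2l//.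
have := ler_norm L; lra.
Unshelve. all: by end_near. Qed.

(** * Normal embedding of small balls *)

(** Following the closest point along the chord from [x] to [y] gives a path in
    [X] which stays in the ball and whose Lipschitz constant is at most
    [2 |x - y|]. *)
Lemma LNE_eball X (K r : R) p : closed X -> X p -> 0 < r -> 3 * r <= K ->
  (forall a, enorm (p - a) < r -> touching_balls X K a) ->
  LNE (X `&` [set a | enorm (p - a) < r]).
Proof.
move=> Xcl Xp r0 rK touch; set U := [set a | enorm (p - a) < r].
have K0 : 0 < K by lra.
have distU a : U a -> dist a X < r.
  by move=> pa; apply: le_lt_trans pa; rewrite (enormB p); exact: dist_le.
have [f fP] := choice (fun a => closest_points_nonempty X a Xcl (ex_intro _ p Xp)).
have fX x : X x -> f x = x.
  move=> Xx; have [_ dE] := fP x.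
  apply/esym/eqP; rewrite -subr_eq0; apply/eqP/enorm_eq0/eqP.
  rewrite eq_le enorm_ge0 andbT -dE; apply: le_trans (dist_le X x x Xx) _.
  by rewrite subrr enorm0.
pose seg x y t : 'rV[R]_n := (1 - t) *: x + t *: y.
have segU x y t : 0 <= t <= 1 -> U x -> U y -> U (seg x y t) by exact: eball_convex.
have main x y : (X `&` U) x -> (X `&` U) y -> exists2 g,
    paths (X `&` U) x y g & (path_length g <= (2 * enorm (x - y))%:E)%E.
  move=> [Xx Ux] [Xy Uy]; pose g t := f (seg x y t).
  have gL s t : 0 <= s <= 1 -> 0 <= t <= 1 ->
      enorm (g s - g t) <= 2 * enorm (x - y) * `|s - t|.
    move=> s01 t01; have Us := segU _ _ _ s01 Ux Uy; have Ut := segU _ _ _ t01 Ux Uy.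
    apply: le_trans (closest_points_lipschitz X K _ _ _ _ K0 (touch _ Us) (touch _ Ut)
      (fP _) (fP _) _) _.
      have := distU _ Us; have := distU _ Ut; lra.
    have -> : seg x y s - seg x y t = (t - s) *: (x - y).
      by apply/rowP => i; rewrite !mxE; ring.
    by rewrite enormZ distrC -mulrA (mulrC `|_|).
  exists g; last exact: path_length_lipschitz.
  split.
  - exact: lipschitz_within_continuous gL.
  - move=> t t01; have Ut := segU _ _ _ t01 Ux Uy.
    split; first by have [] := fP (seg x y t).
    apply: (closest_point_segment_in_eball X K r t p x y) => //.
    + exact: touch.
    + exact/ltW/distU.
  - by rewrite /g /seg subr0 scale1r scale0r addr0 fX.
  - by rewrite /g /seg subrr scale0r scale1r add0r fX.
split; first split.
- by move=> x y xU yU; have [g gP _] := main x y xU yU; exists g.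
- move=> x y xU yU; have [g gP gL] := main x y xU yU; exists g => //.
  by apply: le_lt_trans gL _; rewrite ltry.
exists 2 => // x y xU yU; have [g gP gL] := main x y xU yU.
by apply: le_trans gL; apply: ereal_inf_lbound; exists g.
Qed.

End ClosestPoints.

Theorem theorem2p8 (R : realType) (n : nat) (X : set 'rV[R]_n) :
  closed X -> has_inner_metric X ->
  forall p : 'rV[R]_n, X p -> closure (medial_axis X) p \/ LNE_at X p.
Proof.
move=> Xcl _ p Xp; have [|pM] := pselect (closure (medial_axis X) p); first by left.
right.
have [r r0 Mr] : exists2 r : R, 0 < r & forall b, enorm (p - b) < r -> ~ medial_axis X b.
  have [B [/nbhs_ballP[r /= r0 rB] BM]] : exists B, nbhs p B /\ ~ (medial_axis X `&` B !=set0).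
    apply: contrapT => h; apply: pM => B pB; apply: contrapT => BM.
    by apply: h; exists B.
  exists r => // b pb bM; apply: BM; exists b; split=> //; apply: rB.
  by rewrite -ball_normE /=; apply: le_lt_trans pb; exact: norm_le_enorm.
(* Touching balls of radius r / 2 exist within r / 8 of p, because
   r / 2 + r / 8 < r; and 3 (r / 8) <= r / 2. *)
exists [set a | enorm (p - a) < r / 8]; split.
- exact: open_eball.
- by rewrite /= subrr enorm0 divr_gt0.
apply: (LNE_eball X (r / 2)) => //; [by rewrite divr_gt0|lra|].
move=> a pa; apply: touching_ball => //; first by rewrite divr_gt0.
move=> b ab; apply: Mr; have := enorm_triangle a p b; lra.
Qed.
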